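(* For each $p\in[1,\infty]$, $(\mathbf{Met}_*^p,\times_p,* )$ is a symmetric monoidal category, and the category of commutative monoids internal to this symmetric monoidal category is the category of $p$-subadditive commutative metric monoids.
   Context: A metric space is a pair $(X,d)$ with $X$ a set and $d:X\times X\to[0,\infty]$ satisfying $d(x,x)=0$, $d(x,y)=d(y,x)$ and $d(x,y)\le d(x,z)+d(z,y)$ (an extended pseudometric). A metric map is a function $f$ with $d_Y(f(x),f(y))\le d_X(x,y)$. A pointed metric space $(X,d,x_0)$ is a metric space with a basepoint $x_0\in X$; pointed metric maps are metric maps preserving basepoints. The $p$-norms $\|\cdot\|_p$ are the usual ones on finite tuples ($\max$ of absolute values for $p=\infty$), extended to entries in $[0,\infty]$. $\mathbf{Met}_*^p$ is the category of pointed metric spaces $(X,d,x_0)$ satisfying the $p$-strengthened triangle inequality with respect to $x_0$, i.e. $d(x,y)\le\|(d(x,x_0),d(x_0,y))\|_p$ for all $x,y\in X$, with pointed metric maps as morphisms. For pointed metric spaces $X=(X,d_X,x_0)$, $Y=(Y,d_Y,y_0)$, let $X\times_pY=(X\times Y,d_X\times_pd_Y,(x_0,y_0))$ where $(d_X\times_pd_Y)((x,y),(x',y'))=\|(d_X(x,x'),d_Y(y,y'))\|_p$; on morphisms, $\times_p$ is the product of functions. The unit $*$ is the one-point pointed metric space, and associator, unitors and braiding are given by the usual bijections of cartesian products of sets. A commutative monoid internal to a symmetric monoidal category $(\mathbf{C},\otimes,1)$ is an object $M$ with morphisms $e:1\to M$ and $\mu:M\otimes M\to M$ satisfying the usual associativity,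 commutativity and unit diagrams; morphisms are morphisms $f$ in $\mathbf{C}$ with $f\mu=\mu'(f\otimes f)$ and $fe=e'$. Here the unit $e:*\to M$ is identified with the element it picks out, which is the basepoint of $M$. A $p$-subadditive commutative metric monoid is a tuple $(M,d,+,0)$ with $(M,d,0)$ a pointed metric space and $(M,+,0)$ a commutative monoid such that $d(a+b,a'+b')\le\|(d(a,a'),d(b,b'))\|_p$ for all $a,b,a',b'\in M$. Its morphisms are pointed metric maps that are monoid homomorphisms. *)

(* Defs.v *)
From mathcomp Require Import all_boot all_order all_algebra.
From mathcomp Require Import all_classical all_reals all_analysis.

Set Implicit Arguments.
Unset Strict Implicit.
Unset Printing Implicit Defensive.

Import Order.TTheory GRing.Theory Num.Theory.

Local Open Scope ereal_scope.

Record category := Category {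
  ob :> Type;
  hom : ob -> ob -> Type;
  idm : forall A, hom A A;
  comp : forall A B C, hom B C -> hom A B -> hom A C;
  comp1m : forall A B (f : hom A B), comp (idm B) f = f;
  compm1 : forall A B (f : hom A B), comp f (idm A) = f;
  compmA : forall A B C D (h : hom C D) (g : hom B C) (f : hom A B),
    comp h (comp g f) = comp (comp h g) f }.

Arguments hom {c} A B.
Arguments idm {c} A.
Arguments comp {c A B C} g f.

Notation "g \oc f" := (comp g f) (at level 50, left associativity).

Definition is_iso (C : category) (A B : C) (f : hom A B) : Prop :=
  exists g : hom B A, g \oc f = idm A /\ f \oc g = idm B.

Record functor (C D : category) := Functor {
  fob :> C -> D;
  fmap : forall A B, hom A B -> hom (fob A) (fob B);
  fmap_id : forall A, fmap (idm A) = idm (fob A);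
  fmap_comp : forall A B E (g : hom B E) (f : hom A B),
    fmap (g \oc f) = fmap g \oc fmap f }.

Arguments fmap {C D} F {A B} f : rename.

Definition functor_id (C : category) : functor C C :=
  @Functor C C id (fun A B f => f) (fun=> erefl) (fun _ _ _ _ _ => erefl).

Section FunctorComp.
Variables (C D E : category) (G : functor D E) (F : functor C D).

Let fmap_compF A B (f : hom A B) : hom (G (F A)) (G (F B)) := fmap G (fmap F f).

Lemma functor_comp_id A : fmap_compF (idm A) = idm _.
Proof. by rewrite /fmap_compF !fmap_id. Qed.

Lemma functor_comp_comp A B X (g : hom B X) (f : hom A B) :
  fmap_compF (g \oc f) = fmap_compF g \oc fmap_compF f.
Proof. by rewrite /fmap_compF !fmap_comp. Qed.

Definition functor_comp : functor C E :=
  Functor functor_comp_id functor_comp_comp.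

End FunctorComp.

Definition is_isomorphism_of_categories (C D : category) (F : functor C D) :
    Prop :=
  exists G : functor D C,
    functor_comp G F = functor_id C /\ functor_comp F G = functor_id D.

Record monoidal_data (C : category) := MonoidalData {
  tens : C -> C -> C;
  tensm : forall A A' B B',
    hom A A' -> hom B B' -> hom (tens A B) (tens A' B');
  munit : C;
  massoc : forall X Y Z, hom (tens (tens X Y) Z) (tens X (tens Y Z));
  mlunit : forall X, hom (tens munit X) X;
  mrunit : forall X, hom (tens X munit) X;
  mbraid : forall X Y, hom (tens X Y) (tens Y X) }.

Arguments tens {C} m A B : rename.
Arguments tensm {C} m {A A' B B'} f g : rename.
Arguments massoc {C} m X Y Z : rename.
Arguments mlunit {C} m X : rename.
Arguments mrunit {C} m X : rename.
Arguments mbraid {C} m X Y : rename.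

Section SymmetricMonoidal.
Variables (C : category) (S : monoidal_data C).

Local Notation "A ** B" := (tens S A B) (at level 40, left associativity).
Local Notation "f *** g" := (tensm S f g) (at level 40, left associativity).

Record is_symmetric_monoidal : Prop := {
  tensm_id : forall A B : C, idm A *** idm B = idm (A ** B);
  tensm_comp : forall (A A' A'' B B' B'' : C) (f' : hom A' A'') (f : hom A A')
      (g' : hom B' B'') (g : hom B B'),
    (f' \oc f) *** (g' \oc g) = (f' *** g') \oc (f *** g);
  massoc_iso : forall X Y Z, is_iso (massoc S X Y Z);
  mlunit_iso : forall X, is_iso (mlunit S X);
  mrunit_iso : forall X, is_iso (mrunit S X);
  mbraid_iso : forall X Y, is_iso (mbraid S X Y);
  massoc_natural : forall (X X' Y Y' Z Z' : C) (f : hom X X') (g : hom Y Y')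
      (h : hom Z Z'),
    massoc S X' Y' Z' \oc ((f *** g) *** h) =
    (f *** (g *** h)) \oc massoc S X Y Z;
  mlunit_natural : forall (X X' : C) (f : hom X X'),
    mlunit S X' \oc (idm (munit S) *** f) = f \oc mlunit S X;
  mrunit_natural : forall (X X' : C) (f : hom X X'),
    mrunit S X' \oc (f *** idm (munit S)) = f \oc mrunit S X;
  mbraid_natural : forall (X X' Y Y' : C) (f : hom X X') (g : hom Y Y'),
    mbraid S X' Y' \oc (f *** g) = (g *** f) \oc mbraid S X Y;
  mpentagon : forall W X Y Z : C,
    massoc S W X (Y ** Z) \oc massoc S (W ** X) Y Z =
    (idm W *** massoc S X Y Z) \oc massoc S W (X ** Y) Z
      \oc (massoc S W X Y *** idm Z);
  mtriangle : forall X Y : C,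
    (idm X *** mlunit S Y) \oc massoc S X (munit S) Y =
    mrunit S X *** idm Y;
  mhexagon : forall X Y Z : C,
    massoc S Y Z X \oc mbraid S X (Y ** Z) \oc massoc S X Y Z =
    (idm Y *** mbraid S X Z) \oc massoc S Y X Z
      \oc (mbraid S X Y *** idm Z);
  msymmetry : forall X Y : C,
    mbraid S Y X \oc mbraid S X Y = idm (X ** Y) }.

End SymmetricMonoidal.

Record symmetric_monoidal (C : category) := SymmetricMonoidal {
  sm_data :> monoidal_data C;
  sm_laws : is_symmetric_monoidal sm_data }.

Section CommutativeMonoids.
Variables (C : category) (S : symmetric_monoidal C).

Record cmon := CMon {
  cmon_ob : C;
  cmon_e : hom (munit S) cmon_ob;
  cmon_mu : hom (tens S cmon_ob cmon_ob) cmon_ob;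
  cmon_assoc : cmon_mu \oc tensm S cmon_mu (idm cmon_ob) =
    cmon_mu \oc tensm S (idm cmon_ob) cmon_mu
      \oc massoc S cmon_ob cmon_ob cmon_ob;
  cmon_comm : cmon_mu \oc mbraid S cmon_ob cmon_ob = cmon_mu;
  cmon_lunit : cmon_mu \oc tensm S cmon_e (idm cmon_ob) = mlunit S cmon_ob;
  cmon_runit : cmon_mu \oc tensm S (idm cmon_ob) cmon_e = mrunit S cmon_ob }.

Record cmon_hom (M N : cmon) := CMonHom {
  cmon_hom_mor : hom (cmon_ob M) (cmon_ob N);
  cmon_hom_mu : cmon_hom_mor \oc cmon_mu M =
    cmon_mu N \oc tensm S cmon_hom_mor cmon_hom_mor;
  cmon_hom_e : cmon_hom_mor \oc cmon_e M = cmon_e N }.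

Lemma cmon_hom_eq M N (f g : cmon_hom M N) :
  cmon_hom_mor f = cmon_hom_mor g -> f = g.
Proof.
case: f g => [f f1 f2] [g g1 g2] /= fg; case: g / fg g1 g2 => g1 g2.
by congr CMonHom; exact: Prop_irrelevance.
Qed.

Lemma cmon_id_mu M : idm (cmon_ob M) \oc cmon_mu M =
  cmon_mu M \oc tensm S (idm (cmon_ob M)) (idm (cmon_ob M)).
Proof. by rewrite (tensm_id (sm_laws S)) comp1m compm1. Qed.

Definition cmon_id M : cmon_hom M M := CMonHom (cmon_id_mu M) (comp1m _).

Section Comp.
Variables (M N P : cmon) (g : cmon_hom N P) (f : cmon_hom M N).
Let gf := cmon_hom_mor g \oc cmon_hom_mor f.

Lemma cmon_comp_mu : gf \oc cmon_mu M = cmon_mu P \oc tensm S gf gf.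
Proof.
rewrite (tensm_comp (sm_laws S)) compmA -cmon_hom_mu -!compmA.
by rewrite cmon_hom_mu.
Qed.

Lemma cmon_comp_e : gf \oc cmon_e M = cmon_e P.
Proof. by rewrite -compmA !cmon_hom_e. Qed.

Definition cmon_comp : cmon_hom M P := CMonHom cmon_comp_mu cmon_comp_e.
End Comp.

Definition cmon_category : category.
Proof.
refine (@Category cmon cmon_hom cmon_id cmon_comp _ _ _).
- by move=> A B f; apply: cmon_hom_eq; exact: comp1m.
- by move=> A B f; apply: cmon_hom_eq; exact: compm1.
- by move=> A B D E h g f; apply: cmon_hom_eq; exact: compmA.
Defined.

End CommutativeMonoids.

(* Meant for 1 <= p; the junk value p = -oo is read as p = +oo. *)
Definition pnorm (R : realType) (p : \bar R) (s : seq (\bar R)) : \bar R :=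
  if p is r%:E then (\sum_(x <- s) `|x| `^ r) `^ (r^-1)%R
  else \big[maxe/0]_(x <- s) `|x|.

Record is_metric (R : realType) (T : Type) (d : T -> T -> \bar R) : Prop := {
  metric_ge0 : forall x y, 0 <= d x y;
  metric_refl : forall x, d x x = 0;
  metric_sym : forall x y, d x y = d y x;
  metric_triangle : forall x y z, d x y <= d x z + d z y }.

(* No axiom on d is included: see [is_metric]. *)
Record pointed_space (R : realType) := PointedSpace {
  carrier :> Type;
  dist : carrier -> carrier -> \bar R;
  base : carrier }.

Arguments dist {R} X x y : rename.
Arguments base {R} X : rename.

Definition p_strengthened (R : realType) (p : \bar R) (X : pointed_space R) :
    Prop :=
  forall x y : X, dist X x y <= pnorm p [:: dist X x (base X); dist X (base X) y].

Section PointedMetricMaps.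
Variable R : realType.

Record is_pmap (X Y : pointed_space R) (f : X -> Y) : Prop := {
  pmap_le : forall x y, dist Y (f x) (f y) <= dist X x y;
  pmap_base : f (base X) = base Y }.

Record pmap (X Y : pointed_space R) := PMap {
  pmap_fun :> X -> Y;
  pmap_prop : is_pmap pmap_fun }.

Lemma pmap_eq (X Y : pointed_space R) (f g : pmap X Y) : f =1 g -> f = g.
Proof.
case: f g => [f f1] [g g1] /= /funext fg; case: g / fg g1 => g1.
by congr PMap; exact: Prop_irrelevance.
Qed.

Lemma is_pmap_id (X : pointed_space R) : is_pmap (@id X).
Proof. by split. Qed.

Lemma is_pmap_comp (X Y Z : pointed_space R) (g : Y -> Z) (f : X -> Y) :
  is_pmap g -> is_pmap f -> is_pmap (g \o f).
Proof.
move=> [g1 g2] [f1 f2]; split=> [x y|]; last by rewrite /= f2.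
exact: le_trans (g1 _ _) (f1 _ _).
Qed.

End PointedMetricMaps.

Section MetP.
Variables (R : realType) (p : \bar R).

Definition is_metp (X : pointed_space R) : Prop :=
  is_metric (dist X) /\ p_strengthened p X.

Record metp := MetP {
  metp_space :> pointed_space R;
  metp_prop : is_metp metp_space }.

Definition metp_category : category.
Proof.
refine (@Category metp (fun X Y => pmap X Y) (fun X => PMap (is_pmap_id X))
  (fun X Y Z g f => PMap (is_pmap_comp (pmap_prop g) (pmap_prop f))) _ _ _).
- by move=> X Y f; exact: pmap_eq.
- by move=> X Y f; exact: pmap_eq.
- by move=> X Y Z T h g f; exact: pmap_eq.
Defined.

Definition prod_space (X Y : pointed_space R) : pointed_space R :=
  @PointedSpace R (X * Y)
    (fun u v => pnorm p [:: dist X u.1 v.1; dist Y u.2 v.2])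
    (base X, base Y).

Definition unit_space : pointed_space R :=
  @PointedSpace R unit (fun _ _ => 0) tt.

Definition prod_map (X X' Y Y' : Type) (f : X -> X') (g : Y -> Y') :
    X * Y -> X' * Y' :=
  fun u => (f u.1, g u.2).

Definition assoc_map (X Y Z : Type) : (X * Y) * Z -> X * (Y * Z) :=
  fun u => (u.1.1, (u.1.2, u.2)).

Definition lunit_map (X : Type) : unit * X -> X := snd.

Definition runit_map (X : Type) : X * unit -> X := fst.

Definition braid_map (X Y : Type) : X * Y -> Y * X := fun u => (u.2, u.1).

(* The objects and functions defined above are objects and morphisms of
   Met_*^p. This is a claim about p, to be proved before the monoidal data can
   be formed in [metp_category]. *)
Record prod_closed : Prop := {
  prod_is_metp : forall X Y : metp, is_metp (prod_space X Y);
  prod_map_is_pmap : forall (X X' Y Y' : metp) (f : pmap X X') (g : pmap Y Y'),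
    is_pmap (X := prod_space X Y) (Y := prod_space X' Y') (prod_map f g);
  unit_is_metp : is_metp unit_space;
  assoc_is_pmap : forall X Y Z : metp,
    is_pmap (X := prod_space (prod_space X Y) Z)
      (Y := prod_space X (prod_space Y Z)) (@assoc_map X Y Z);
  lunit_is_pmap : forall X : metp,
    is_pmap (X := prod_space unit_space X) (Y := X) (@lunit_map X);
  runit_is_pmap : forall X : metp,
    is_pmap (X := prod_space X unit_space) (Y := X) (@runit_map X);
  braid_is_pmap : forall X Y : metp,
    is_pmap (X := prod_space X Y) (Y := prod_space Y X) (@braid_map X Y) }.

Definition metp_monoidal (W : prod_closed) : monoidal_data metp_category :=
  @MonoidalData metp_category
    (fun X Y : metp => MetP (prod_is_metp W X Y))
    (fun X X' Y Y' f g => PMap (prod_map_is_pmap W f g))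
    (MetP (unit_is_metp W))
    (fun X Y Z => PMap (assoc_is_pmap W X Y Z))
    (fun X => PMap (lunit_is_pmap W X))
    (fun X => PMap (runit_is_pmap W X))
    (fun X Y => PMap (braid_is_pmap W X Y)).

End MetP.

(* The bare data (M, d, +, 0), where 0 is the base point; the axioms are in
   [is_psubadditive]. The algebraic structure [nmodType] is not used, because
   it carries a choice operator besides + and 0. *)
Record metric_monoid (R : realType) := MetricMonoid {
  mm_space :> pointed_space R;
  mm_add : mm_space -> mm_space -> mm_space }.

Arguments mm_add {R} M x y : rename.

Section PSubadditive.
Variables (R : realType) (p : \bar R).

Record is_psubadditive (M : metric_monoid R) : Prop := {
  psub_metric : is_metric (dist M);
  psub_addA : associative (mm_add M);
  psub_addC : commutative (mm_add M);
  psub_add0 : left_id (base M) (mm_add M);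
  psub_le : forall a b a' b' : M,
    dist M (mm_add M a b) (mm_add M a' b') <=
      pnorm p [:: dist M a a'; dist M b b'] }.

Record psubmon := PSubMon {
  psubmon_mm :> metric_monoid R;
  psubmon_prop : is_psubadditive psubmon_mm }.

(* A monoid homomorphism preserves 0 by [pmap_base]. *)
Record is_mm_hom (M N : metric_monoid R) (f : M -> N) : Prop := {
  mm_hom_pmap : is_pmap f;
  mm_hom_add : {morph f : x y / mm_add M x y >-> mm_add N x y} }.

Record mm_hom (M N : metric_monoid R) := MMHom {
  mm_hom_fun :> M -> N;
  mm_hom_prop : is_mm_hom mm_hom_fun }.

Lemma mm_hom_eq (M N : metric_monoid R) (f g : mm_hom M N) : f =1 g -> f = g.
Proof.
case: f g => [f f1] [g g1] /= /funext fg; case: g / fg g1 => g1.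
by congr MMHom; exact: Prop_irrelevance.
Qed.

Lemma is_mm_hom_id (M : metric_monoid R) : is_mm_hom (@id M).
Proof. by split=> //; exact: is_pmap_id. Qed.

Lemma is_mm_hom_comp (M N P : metric_monoid R) (g : N -> P) (f : M -> N) :
  is_mm_hom g -> is_mm_hom f -> is_mm_hom (g \o f).
Proof.
move=> [g1 g2] [f1 f2]; split; first exact: is_pmap_comp.
by move=> x y /=; rewrite f2 g2.
Qed.

Definition psubmon_category : category.
Proof.
refine (@Category psubmon (fun M N => mm_hom M N)
  (fun M => MMHom (is_mm_hom_id M))
  (fun M N P g f => MMHom (is_mm_hom_comp (mm_hom_prop g) (mm_hom_prop f)))
  _ _ _).
- by move=> X Y f; exact: mm_hom_eq.
- by move=> X Y f; exact: mm_hom_eq.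
- by move=> X Y Z T h g f; exact: mm_hom_eq.
Defined.

End PSubadditive.

Section Comparison.
Variables (R : realType) (p : \bar R) (W : prod_closed p).
Variable HS : is_symmetric_monoidal (metp_monoidal W).

Definition metp_symmetric_monoidal : symmetric_monoidal (metp_category p) :=
  SymmetricMonoidal HS.

Local Notation CM := (cmon metp_symmetric_monoidal).

Definition cmon_space (M : CM) : metp p := cmon_ob M.

Definition cmon_tuple (M : CM) : metric_monoid R :=
  @MetricMonoid R
    (@PointedSpace R (cmon_space M) (dist (cmon_space M))
      ((cmon_e M : pmap (unit_space R) (cmon_space M)) tt))
    (fun a b =>
      (cmon_mu M : pmap (prod_space p (cmon_space M) (cmon_space M))
                     (cmon_space M)) (a, b)).

Definition cmon_hom_map (M N : CM) (f : cmon_hom M N) :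
    cmon_tuple M -> cmon_tuple N :=
  (cmon_hom_mor f : pmap (cmon_space M) (cmon_space N)).

(* (M, e, mu) |-> (M, d, mu, e) and f |-> f take values in p-subadditive
   commutative metric monoids and their morphisms. *)
Record tuple_closed : Prop := {
  cmon_tuple_psub : forall M : CM, is_psubadditive p (cmon_tuple M);
  cmon_hom_map_mm : forall (M N : CM) (f : cmon_hom M N),
    is_mm_hom (cmon_hom_map f) }.

Definition comparison (V : tuple_closed) :
  functor (cmon_category metp_symmetric_monoidal) (psubmon_category p).
Proof.
refine (@Functor (cmon_category metp_symmetric_monoidal) (psubmon_category p)
  (fun M : CM => PSubMon (cmon_tuple_psub V M))
  (fun M N f => MMHom (cmon_hom_map_mm V f)) _ _).
- by move=> M; exact: mm_hom_eq.
- by move=> M N P g f; exact: mm_hom_eq.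
Defined.

End Comparison.

(* Main.v *)
From Pilot Require Import Defs.
From mathcomp Require Import all_boot all_order all_algebra.
From mathcomp Require Import all_classical all_reals all_analysis.
Import Pilot.Defs.

Set Implicit Arguments.
Unset Strict Implicit.
Unset Printing Implicit Defensive.

Import Order.TTheory GRing.Theory Num.Theory.

Local Open Scope ereal_scope.

(** Everything rests on two facts about the [p]-norm of finite sequences with
entries in [[0, +oo]].

The first is that norms can be nested: the norm of [s ++ t] is the norm of the
pair formed by the norm of [s] and the norm of [t] ([pnorm_cat]), while the norm
is invariant under permutation and sends [[:: a]] to [a]. Hence
[(a, b) |-> pnorm p [:: a; b]] is associative, commutative, has unit [0] and
satisfies the interchange law [pnormACA]. Associativity, unit and commutativity
say that the structural bijections of cartesian products are isometries for the
product distances; interchange, with monotonicity, says that products inherit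
the [p]-strengthened triangle inequality. The second fact is Minkowski's
inequality ([pnorm_minkowski]), which gives products the ordinary triangle
inequality. The coherence laws are then equalities of functions between sets.

In a commutative monoid internal to Met_*^p, the diagrams evaluated at points
are the monoid axioms, and that [mu] is a metric map is exactly
[p]-subadditivity. In the other direction a [p]-subadditive monoid lies in
Met_*^p, since [d (x, y) = d (x + 0, 0 + y)] is at most the norm of
[(d (x, 0), d (0, y))] ([psubadditive_is_metp]). So the comparison functor is
bijective on objects and on morphisms.

Such a functor is an isomorphism of categories
([isomorphism_of_categoriesP]). Since the two composites agree with identities
on objects only up to a propositional equality, their equality is checked on
morphisms packed with their source and target ([arrow], [functor_eq]), which
have a common type. *)

(** * Norms of sequences in the extended half-line *)

(** The element [0] is not neutral for [maxe] on [\bar R], so the laws of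
iterated monoid operations do not apply to the sup norm; its upper bounds
determine it and are easier to handle. *)
Lemma pnormy_le (R : realType) (s : seq (\bar R)) (x : \bar R) : 0 <= x ->
  (pnorm +oo s <= x) = all (fun y => `|y| <= x) s.
Proof.
move=> x0; rewrite /pnorm; elim: s => [|y s IHs] /=; first by rewrite big_nil.
by rewrite big_cons ge_max IHs.
Qed.

Lemma eq_ge0_le (R : realType) (u v : \bar R) : 0 <= u -> 0 <= v ->
  (forall x, 0 <= x -> (u <= x) = (v <= x)) -> u = v.
Proof. by move=> u0 v0 uv; apply/le_anti; rewrite (uv v)// -(uv u)// !lexx. Qed.

Section PNorm.
Variables (R : realType) (p : \bar R).
Hypothesis p_ge1 : 1%:E <= p.
Implicit Types (a b c d : \bar R) (s t : seq (\bar R)).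

(** The hypothesis on [p] rules out the junk value [-oo]. The predicate ranges
over norms, not exponents, so that it can be inferred from a goal on [pnorm p].
*)
Lemma pnorm_cases (P : (seq (\bar R) -> \bar R) -> Prop) :
  (forall r, (1 <= r)%R -> P (pnorm r%:E)) -> P (pnorm +oo) -> P (pnorm p).
Proof.
by move: p_ge1; case: p => [r|//|//]; rewrite lee_fin => r1 + _; exact.
Qed.

Lemma pnorm_ge0 s : 0 <= pnorm p s.
Proof.
elim/pnorm_cases : _ => [r _|]; first exact: poweR_ge0.
by rewrite /pnorm; elim/big_ind: _ => // x y x0 y0; rewrite le_max x0.
Qed.

Lemma pnorm_perm s t : perm_eq s t -> pnorm p s = pnorm p t.
Proof.
move=> st; have := pnorm_ge0 s; have := pnorm_ge0 t.
elim/pnorm_cases : _ => [r _|] t0 s0.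
  by rewrite /pnorm; congr (_ `^ _); exact: perm_big.
by apply: eq_ge0_le => // x x0; rewrite !pnormy_le// (perm_all _ st).
Qed.

Lemma pnorm_nil : pnorm p [::] = 0.
Proof.
elim/pnorm_cases : _ => [r r1|]; rewrite /pnorm big_nil//.
by rewrite poweR0r// invr_eq0 gt_eqF// (lt_le_trans ltr01).
Qed.

Lemma pnorm_seq1 a : 0 <= a -> pnorm p [:: a] = a.
Proof.
move=> a0; elim/pnorm_cases : _ => [r r1|]; rewrite /pnorm.
  rewrite big_seq1 gee0_abs// -poweRrM divff ?poweRe1//.
  by rewrite gt_eqF// (lt_le_trans ltr01).
by rewrite big_cons big_nil gee0_abs//; apply/max_idPl.
Qed.

(** For finite [r], raising the inner norms to the power [r] cancels their
exponent [r^-1]; for the sup norm, an upper bound of a concatenation is a common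
upper bound of its two parts. *)
Lemma pnorm_cat s t : pnorm p (s ++ t) = pnorm p [:: pnorm p s; pnorm p t].
Proof.
have := pnorm_ge0 s; have := pnorm_ge0 t.
have := pnorm_ge0 (s ++ t); have := pnorm_ge0 [:: pnorm p s; pnorm p t].
elim/pnorm_cases : _ => [r r1|] l0 r0 t0 s0.
  have rK x : 0 <= x -> (x `^ r^-1) `^ r = x.
    move=> x0; rewrite -poweRrM mulVf ?poweRe1//.
    by rewrite gt_eqF// (lt_le_trans ltr01).
  rewrite {1 2}/pnorm big_cons big_seq1 !gee0_abs// big_cat/= /pnorm.
  by rewrite !rK// sume_ge0// => x _; exact: poweR_ge0.
apply: eq_ge0_le => // x x0.
by rewrite !pnormy_le//= all_cat !gee0_abs// !pnormy_le// andbT.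
Qed.

Lemma le_pnorm2 a b c d : 0 <= a -> 0 <= b -> a <= c -> b <= d ->
  pnorm p [:: a; b] <= pnorm p [:: c; d].
Proof.
move=> a0 b0 ac bd; have c0 := le_trans a0 ac; have d0 := le_trans b0 bd.
elim/pnorm_cases : _ => [r r1|]; rewrite /pnorm !big_cons !big_nil !gee0_abs//.
  have r0 : (0 <= r)%R by rewrite (le_trans ler01).
  have ge0_in (x : \bar R) : 0 <= x -> x \in `[0%E, +oo%E]%O.
    by move=> x0; rewrite in_itv/= x0 leey.
  by apply: gt0_ler_poweR; rewrite ?ge0_in ?invr_ge0 ?adde_ge0 ?poweR_ge0//
    leeD ?adde0 ?gt0_ler_poweR ?ge0_in.
by rewrite !ge_max !le_max ac bd lexx !orbT.
Qed.

Lemma pnormC a b : pnorm p [:: a; b] = pnorm p [:: b; a].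
Proof. by apply: pnorm_perm; rewrite (perm_catC [:: a] [:: b]). Qed.

Lemma pnorm0l a : 0 <= a -> pnorm p [:: 0; a] = a.
Proof.
move=> a0; have := pnorm_cat [::] [:: a].
by rewrite pnorm_nil !pnorm_seq1.
Qed.

Lemma pnorm0r a : 0 <= a -> pnorm p [:: a; 0] = a.
Proof. by rewrite pnormC; exact: pnorm0l. Qed.

Lemma pnormA a b c : 0 <= a -> 0 <= c ->
  pnorm p [:: a; pnorm p [:: b; c]] = pnorm p [:: pnorm p [:: a; b]; c].
Proof.
move=> a0 c0; have := pnorm_cat [:: a] [:: b; c].
have := pnorm_cat [:: a; b] [:: c].
by rewrite !pnorm_seq1//= => -> ->.
Qed.

Lemma pnormACA a b c d :
  pnorm p [:: pnorm p [:: a; b]; pnorm p [:: c; d]] =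
  pnorm p [:: pnorm p [:: a; c]; pnorm p [:: b; d]].
Proof.
rewrite -!pnorm_cat; apply: pnorm_perm.
by rewrite /= perm_cons (perm_catCA [:: b] [:: c] [:: d]).
Qed.

Lemma pnorm_pinfty a : 0 <= a -> pnorm p [:: a; +oo] = +oo.
Proof.
move=> a0; apply/eqP; rewrite -leye_eq -[leLHS]pnorm0l//.
exact: le_pnorm2.
Qed.

(** An infinite entry makes the right-hand side infinite. For real entries and a
finite exponent, this is Minkowski's inequality for the counting measure on
[nat], the pairs being extended by zero to sequences; for the sup norm it is
immediate from the upper bounds. *)
Lemma pnorm_minkowski a b c d : 0 <= a -> 0 <= b -> 0 <= c -> 0 <= d ->
  pnorm p [:: a + c; b + d] <= pnorm p [:: a; b] + pnorm p [:: c; d].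
Proof.
have ooD x : 0 <= x -> +oo + x = +oo :> \bar R.
  by move=> x0; rewrite addye// gt_eqF// (lt_le_trans _ x0).
have Doo x : 0 <= x -> x + +oo = +oo :> \bar R by move=> /ooD; rewrite addeC.
have [->|aoo] := eqVneq a +oo.
  move=> _ b0 c0 d0; rewrite [pnorm p [:: +oo; b]]pnormC pnorm_pinfty//.
  by rewrite !ooD ?leey ?pnorm_ge0.
have [->|boo] := eqVneq b +oo.
  by move=> a0 _ c0 d0; rewrite (pnorm_pinfty a0) !ooD ?leey ?pnorm_ge0.
have [->|coo] := eqVneq c +oo.
  move=> a0 b0 _ d0; rewrite [pnorm p [:: +oo; d]]pnormC pnorm_pinfty//.
  by rewrite !Doo ?leey ?pnorm_ge0.
have [->|doo] := eqVneq d +oo.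
  by move=> a0 b0 c0 _; rewrite (pnorm_pinfty c0) !Doo ?leey ?pnorm_ge0.
case: a aoo => [a||]// _ a0; case: b boo => [b||]// _ b0.
case: c coo => [c||]// _ c0; case: d doo => [d||]// _ d0.
have := pnorm_ge0 [:: a%:E; b%:E]; have := pnorm_ge0 [:: c%:E; d%:E].
elim/pnorm_cases : _ => [r r1 _ _|cd0 ab0].
  pose f x y n : R := match n with 0%N => x | 1%N => y | _ => 0%R end.
  have mf x y : measurable_fun setT (f x y) by [].
  have r0 := lt_le_trans ltr01 r1.
  have NE x y :
      Lnorm counting r%:E (EFin \o f x y) = pnorm r%:E [:: x%:E; y%:E].
    rewrite Lnorm_counting// (nneseries_split 0 2); last first.
      by move=> k _; exact: poweR_ge0.
    rewrite ereal_series_cond eseries0 ?adde0; last first.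
      by move=> [//|] [//|n _ _]; rewrite /f /= normr0 powR0// gt_eqF.
    rewrite /pnorm add0n big_mkord !big_ord_recr/= big_ord0 add0e.
    by rewrite big_cons big_seq1.
  have fD : f (a + c)%R (b + d)%R = (f a b \+ f c d)%R.
    by apply/funext => -[|[|n]] //=; rewrite addr0.
  by rewrite -!EFinD -!NE fD; exact: minkowski_EFin.
rewrite pnormy_le ?adde_ge0// /all !gee0_abs ?adde_ge0//.
by rewrite !leeD// /pnorm !big_cons big_nil !gee0_abs// !le_max lexx ?orbT.
Qed.

End PNorm.

(** * Isomorphisms of categories *)

Section Arrows.
Variable C : category.

(** Morphisms whose sources and targets are only propositionally equal are
compared in this common type instead of being transported. *)
Definition arrow (A B : C) (f : hom A B) : {AB : C * C & hom AB.1 AB.2} :=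
  existT _ (A, B) f.

Lemma arrow_inj (A B : C) : injective (@arrow A B).
Proof.
move=> f g fg; have := projT2_eq fg.
by rewrite (Prop_irrelevance (projT1_eq fg) erefl).
Qed.

Lemma arrow_idm (A B : C) : A = B -> arrow (idm A) = arrow (idm B).
Proof. by move=> ->. Qed.

Lemma arrow_dom (A B A' B' : C) (f : hom A B) (f' : hom A' B') :
  arrow f = arrow f' -> A = A'.
Proof. by move=> /(congr1 (fun z => (projT1 z).1)). Qed.

Lemma arrow_comp (A B E A' B' E' : C) (g : hom B E) (f : hom A B)
    (g' : hom B' E') (f' : hom A' B') :
  arrow g = arrow g' -> arrow f = arrow f' ->
  arrow (g \oc f) = arrow (g' \oc f').
Proof.
move=> gg' ff'; have [EA EB] := congr1 (@projT1 _ _) ff'.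
have [_ EE] := congr1 (@projT1 _ _) gg'.
case: A' / EA f' ff' => f' ff'.
case: B' / EB f' g' ff' gg' => f' g' ff' gg'.
case: E' / EE g' gg' => g' gg'.
by rewrite (arrow_inj ff') (arrow_inj gg').
Qed.

End Arrows.

(** Agreement on objects follows from agreement on the identities, whose sources
are the objects. *)
Lemma functor_eq (C D : category) (F G : functor C D) :
  (forall (A B : C) (f : hom A B), arrow (fmap F f) = arrow (fmap G f)) ->
  F = G.
Proof.
case: F G => [F Fm F1 Fc] [G Gm G1 Gc] /= FG.
have FGob : F = G.
  by apply/funext => A; have /arrow_dom := FG _ _ (idm A).
case: G / FGob Gm G1 Gc FG => Gm G1 Gc FG.
have FGm : Fm = Gm.
  apply: functional_extensionality_dep => A.
  apply: functional_extensionality_dep => B.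
  by apply/funext => f; exact: arrow_inj (FG A B f).
case: Gm / FGm G1 Gc {FG} => G1 Gc.
by congr Functor; exact: Prop_irrelevance.
Qed.

(** The inverse is [g] on objects and sends [h : X -> Y] to a morphism
[g X -> g Y] that [F] maps to [h] as a packed arrow: it exists since [F] is full
and [F (g X) = X]. Because [F] is injective on packed arrows, functoriality of
this assignment, and that it undoes [F], can be checked after applying [F]. *)
Lemma isomorphism_of_categoriesP (C D : category) (F : functor C D)
    (g : D -> C) :
  cancel (fob F) g -> cancel g (fob F) ->
  (forall A B : C, injective (@fmap C D F A B)) ->
  (forall (A B : C) (h : hom (F A) (F B)), exists f : hom A B, fmap F f = h) ->
  is_isomorphism_of_categories F.
Proof.
move=> gK Kg Finj Ffull.
have Farrow_inj (A B A' B' : C) (f : hom A B) (f' : hom A' B') :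
    arrow (fmap F f) = arrow (fmap F f') -> arrow f = arrow f'.
  move=> ff'.
  have [/(can_inj gK) EA /(can_inj gK) EB] := congr1 (@projT1 _ _) ff'.
  by case: A' / EA f' ff' => f'; case: B' / EB f' => f' /arrow_inj /Finj ->.
have lift_ex (X Y : D) (h : hom X Y) :
    exists f : hom (g X) (g Y), arrow (fmap F f) = arrow h.
  (* [h] must be moved to the hom-set from [F (g X)] to [F (g Y)]. *)
  suff : forall (X' Y' : D) (EX : X' = X) (EY : Y' = Y),
      exists h' : hom X' Y', arrow h' = arrow h.
    move=> /(_ _ _ (Kg X) (Kg Y)) [h' <-].
    by have [f <-] := Ffull _ _ h'; exists f.
  by move=> X' Y' -> ->; exists h.
pose gm (X Y : D) (h : hom X Y) := projT1 (cid (lift_ex X Y h)).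
have gmK (X Y : D) (h : hom X Y) : arrow (fmap F (gm X Y h)) = arrow h.
  by rewrite /gm; case: cid.
have gm_id X : gm _ _ (idm X) = idm (g X).
  apply/arrow_inj/Farrow_inj; rewrite gmK fmap_id; apply: arrow_idm.
  by rewrite Kg.
have gm_comp (X Y Z : D) (k : hom Y Z) (h : hom X Y) :
    gm _ _ (k \oc h) = gm _ _ k \oc gm _ _ h.
  apply/arrow_inj/Farrow_inj; rewrite gmK fmap_comp.
  by apply: arrow_comp; rewrite gmK.
exists (Functor gm_id gm_comp); split; apply: functor_eq => A B f /=.
  by apply: Farrow_inj; rewrite gmK.
exact: gmK.
Qed.

(** * The symmetric monoidal category of pointed metric spaces *)

Section MetP.
Variables (R : realType) (p : \bar R).
Hypothesis p_ge1 : 1%:E <= p.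

Lemma metp_dist_ge0 (X : metp p) (x y : X) : 0 <= dist X x y.
Proof. exact: metric_ge0 (metp_prop X).1 x y. Qed.

Lemma prod_space_is_metric (X Y : pointed_space R) :
  is_metric (dist X) -> is_metric (dist Y) ->
  is_metric (dist (prod_space p X Y)).
Proof.
move=> mX mY; split=> [u v|u|u v|u v w] /=.
- exact: pnorm_ge0.
- by rewrite (metric_refl mX) (metric_refl mY) pnorm0l.
- by rewrite (metric_sym mX) (metric_sym mY).
- have X0 := metric_ge0 mX; have Y0 := metric_ge0 mY.
  apply: le_trans (pnorm_minkowski p_ge1 _ _ _ _) => //.
  by apply: le_pnorm2 => //; [exact: metric_triangle mX _ _ _
                             |exact: metric_triangle mY _ _ _].
Qed.

(** The inequalities for the two factors bound the distance by a norm of norms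
grouped by factor; interchange regroups it by pairs of points. *)
Lemma prod_space_is_metp (X Y : pointed_space R) :
  is_metp p X -> is_metp p Y -> is_metp p (prod_space p X Y).
Proof.
move=> [mX sX] [mY sY]; split=> [|u v /=]; first exact: prod_space_is_metric.
rewrite pnormACA//.
by apply: le_pnorm2; rewrite ?(metric_ge0 mX) ?(metric_ge0 mY).
Qed.

Lemma metp_prod_closed : prod_closed p.
Proof.
have ge0 := metp_dist_ge0; split.
- by move=> X Y; apply: prod_space_is_metp; exact: metp_prop.
- move=> X X' Y Y' f g; split=> [u v /=|]; last first.
    by rewrite /prod_map /= !pmap_base//; exact: pmap_prop.
  by apply: le_pnorm2 => //; apply: pmap_le; exact: pmap_prop.
- by split=> [|x y /=]; [split=> //= *; rewrite adde0|rewrite pnorm0l].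
- by move=> X Y Z; split=> // u v /=; rewrite pnormA.
- by move=> X; split=> // u v /=; rewrite pnorm0l.
- by move=> X; split=> // u v /=; rewrite pnorm0r.
- by move=> X Y; split=> // u v /=; rewrite pnormC.
Qed.

Lemma pmap_eq1 (X Y : pointed_space R) (f g : pmap X Y) : f = g -> f =1 g.
Proof. by move=> ->. Qed.

Section Monoidal.
Variable W : prod_closed p.
Local Notation S := (metp_monoidal W).

Lemma metp_is_symmetric_monoidal : is_symmetric_monoidal S.
Proof.
have ge0 := metp_dist_ge0; split.
- by move=> A B; apply: pmap_eq => -[].
- by move=> *; exact: pmap_eq.
- move=> X Y Z.
  pose h (u : X * (Y * Z)) : (X * Y) * Z := ((u.1, u.2.1), u.2.2).
  have hP : is_pmap (X := prod_space p X (prod_space p Y Z))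
      (Y := prod_space p (prod_space p X Y) Z) h.
    by split=> // u v /=; rewrite pnormA.
  exists (PMap hP : hom (tens S X (tens S Y Z)) (tens S (tens S X Y) Z)).
  by split; apply: pmap_eq; [move=> [[]]|move=> [? []]].
- move=> X; pose h (x : X) : unit * X := (tt, x).
  have hP : is_pmap (X := X) (Y := prod_space p (unit_space R) X) h.
    by split=> // u v /=; rewrite pnorm0l.
  exists (PMap hP : hom X (tens S (munit S) X)).
  by split; apply: pmap_eq => //; case=> -[].
- move=> X; pose h (x : X) : X * unit := (x, tt).
  have hP : is_pmap (X := X) (Y := prod_space p X (unit_space R)) h.
    by split=> // u v /=; rewrite pnorm0r.
  exists (PMap hP : hom X (tens S X (munit S))).
  by split; apply: pmap_eq => //; case=> ? [].
- by move=> X Y; exists (mbraid S Y X); split; apply: pmap_eq; case.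
- by move=> *; exact: pmap_eq.
- by move=> *; exact: pmap_eq.
- by move=> *; exact: pmap_eq.
- by move=> *; exact: pmap_eq.
- by move=> *; exact: pmap_eq.
- by move=> *; exact: pmap_eq.
- by move=> *; exact: pmap_eq.
- by move=> *; apply: pmap_eq => -[].
Qed.

(** * Internal commutative monoids *)

Variable HS : is_symmetric_monoidal S.
Local Notation SM := (metp_symmetric_monoidal HS).

(** The monoid axioms are the values of the internal diagrams at points, and
[p]-subadditivity is the contraction property of [mu]. *)
Lemma cmon_tuple_closed : tuple_closed HS.
Proof.
split.
  move=> M.
  have muP : is_pmap (X := prod_space p _ _) _ := pmap_prop (cmon_mu M).
  split.
  - exact: (metp_prop (cmon_ob M)).1.
  - by move=> a b c; exact: esym (pmap_eq1 (cmon_assoc M) ((a, b), c)).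
  - by move=> a b; exact: pmap_eq1 (cmon_comm M) (b, a).
  - move=> a; exact: pmap_eq1 (cmon_lunit M) (tt, a).
  - by move=> a b a' b'; exact: pmap_le muP (a, b) (a', b').
move=> M N f; split; last first.
  by move=> a b; exact: pmap_eq1 (cmon_hom_mu f) (a, b).
split; first exact: pmap_le (pmap_prop (cmon_hom_mor f)).
exact: pmap_eq1 (cmon_hom_e f) tt.
Qed.

(** Apply [p]-subadditivity to [d (x + 0, 0 + y)]. *)
Lemma psubadditive_is_metp (M : metric_monoid R) :
  is_psubadditive p M -> is_metp p M.
Proof.
move=> pM; split=> [|x y]; first exact: psub_metric pM.
have add0r (z : M) : mm_add M z (base M) = z.
  by rewrite (psub_addC pM) (psub_add0 pM).
have := psub_le pM x (base M) (base M) y.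
by rewrite add0r (psub_add0 pM).
Qed.

Section Tuple.
Variable M : psubmon p.
Let X : metp_category p := MetP (psubadditive_is_metp (psubmon_prop M)).

Lemma is_pmap_unit : is_pmap (X := unit_space R) (Y := M) (fun=> base M).
Proof.
by split=> // *; rewrite (metric_refl (psub_metric (psubmon_prop M))).
Qed.

Lemma is_pmap_add :
  is_pmap (X := prod_space p M M) (Y := M) (fun u => mm_add M u.1 u.2).
Proof.
split=> [u v|]; first exact: psub_le (psubmon_prop M) _ _ _ _.
exact: psub_add0 (psubmon_prop M) _.
Qed.

Let e : hom (munit SM) X := PMap is_pmap_unit.
Let mu : hom (tens SM X X) X := PMap is_pmap_add.

Definition cmon_of_psubmon : cmon SM.
Proof.
refine (@CMon _ SM X e mu _ _ _ _); apply: pmap_eq => /=.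
- by move=> u; rewrite /= -(psub_addA (psubmon_prop M)).
- by move=> u; rewrite /= (psub_addC (psubmon_prop M)).
- by move=> u; rewrite /= (psub_add0 (psubmon_prop M)).
- move=> u; rewrite /= (psub_addC (psubmon_prop M)).
  by rewrite (psub_add0 (psubmon_prop M)).
Defined.
End Tuple.

Variable V : tuple_closed HS.

Lemma cmon_of_psubmonK : cancel cmon_of_psubmon (fob (comparison V)).
Proof.
case=> [[[T d z] add] pM]; rewrite /= /cmon_tuple /=.
by congr PSubMon; exact: Prop_irrelevance.
Qed.

Lemma cmon_eq (X : pointed_space R) (XP XP' : is_metp p X)
    (e e' : pmap (unit_space R) X) (mu mu' : pmap (prod_space p X X) X)
    A A' C C' L L' U U' : e =1 e' -> mu =1 mu' ->
  @CMon _ SM (MetP XP) e mu A C L U = @CMon _ SM (MetP XP') e' mu' A' C' L' U'.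
Proof.
move=> /pmap_eq ee' /pmap_eq mumu'.
case: e' / ee' A' C' L' U'; case: mu' / mumu'.
case: XP' / (Prop_irrelevance XP XP') => A' C' L' U'.
by congr CMon; exact: Prop_irrelevance.
Qed.

(** The two internal monoids differ only in their base point, which is [b] on
one side and [e tt] on the other; identifying these first makes the remaining
components comparable. *)
Lemma cmon_tupleK : cancel (fob (comparison V)) cmon_of_psubmon.
Proof.
case=> -[[T d b] XP] [/= e eP] [/= mu muP].
have eb : e tt = b := pmap_base eP.
case: b / eb XP eP muP => XP eP muP A C L U.
by apply: cmon_eq => [[]|[]].
Qed.

Lemma comparison_faithful (M N : cmon SM) :
  injective (@fmap _ _ (comparison V) M N).
Proof.
move=> f g fg; apply/cmon_hom_eq/pmap_eq => x.
have fgE : cmon_hom_map f = cmon_hom_map g := congr1 (@mm_hom_fun R _ _) fg.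
by rewrite -[LHS]/(cmon_hom_map f x) fgE.
Qed.

(** A morphism of the associated tuples preserves [e tt] instead of the base
point of the underlying space; the two agree as [e] is a pointed map. *)
Lemma comparison_full (M N : cmon SM)
    (h : mm_hom (cmon_tuple M) (cmon_tuple N)) :
  exists f : cmon_hom M N, MMHom (cmon_hom_map_mm V f) = h.
Proof.
have [hP hD] := mm_hom_prop h.
have fP : is_pmap (X := cmon_space M) (Y := cmon_space N) h.
  split=> [x y|]; first exact: pmap_le hP x y.
  rewrite -(pmap_base (pmap_prop (cmon_e M))).
  exact: etrans (pmap_base hP) (pmap_base (pmap_prop (cmon_e N))).
pose f : hom (cmon_ob M) (cmon_ob N) := PMap fP.
have f_mu : f \oc cmon_mu M = cmon_mu N \oc tensm SM f f.
  by apply: pmap_eq => -[a b]; exact: hD a b.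
have f_e : f \oc cmon_e M = cmon_e N.
  by apply: pmap_eq => -[]; exact: pmap_base hP.
by exists (CMonHom f_mu f_e); exact: mm_hom_eq.
Qed.
End Monoidal.
End MetP.

Theorem theorem1p5 (R : realType) (p : \bar R) (hp : (1%:E <= p)%E) :
  exists (W : prod_closed p)
         (HS : is_symmetric_monoidal (metp_monoidal W))
         (V : tuple_closed HS),
    is_isomorphism_of_categories (comparison V).
Proof.
exists (metp_prod_closed hp), (metp_is_symmetric_monoidal hp _),
  (cmon_tuple_closed _).
apply: isomorphism_of_categoriesP.
- exact: cmon_tupleK.
- exact: cmon_of_psubmonK.
- exact: comparison_faithful.
- exact: comparison_full.
Qed.
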